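(* Let $B>1$ and $N>1$ be integers with $\gcd(N,B)=1$, let $e=\operatorname{ord}(B,N)=3k$, and suppose $N\in M_3(B)$. Then: (i) $m_3(1)=1$; (ii) if $N$ is odd, $m_3(2)=1$; (iii) if $3\nmid N$ and $N\ne 7$, $m_3(3)=1$.
   Context: $\operatorname{ord}(B,N)$ is the least positive integer $e$ with $B^e\equiv1\pmod N$. For a divisor $d$ of $e$ put $k=e/d$. For $x$ with $1\le x<N$, $\gcd(x,N)=1$, let $x/N=0.a_1a_2\ldots$ be its base-$B$ expansion (purely periodic with period $a_1\ldots a_e$), and let $S_d(x)=\sum_{j=1}^d\sum_{i=1}^k a_{(j-1)k+i}B^{k-i}$ be the sum of the integers represented in base $B$ by the $d$ consecutive blocks of length $k$ of the period. We say $N\in M_d(B)$ if $d\mid e$ and $S_d(x)\equiv0\pmod{B^k-1}$ for every such $x$. When $N\in M_d(B)$, the multiplier is the integer $m_d(x)=S_d(x)/(B^k-1)$; thus $m_3(x)=1$ means the three blocks of length $k$ of the period of $x/N$ sum to exactly $B^k-1$. *)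

(* Defs.v *)
From mathcomp Require Import all_boot all_solvable.

Set Implicit Arguments.
Unset Strict Implicit.
Unset Printing Implicit Defensive.

Lemma ordm_ex (B N : nat) :
  exists e, coprime B N ==> (0 < e) && (B ^ e == 1 %[mod N]).
Proof.
case: N => [|N].
  exists 1; apply/implyP; rewrite /coprime gcdn0 => /eqP ->.
  by rewrite exp1n eqxx.
exists (totient N.+1); apply/implyP => coBN.
by rewrite totient_gt0 /=; apply/eqP; apply: Euler_exp_totient.
Qed.

(* Junk value 0 when B is not invertible modulo N. *)
Definition ordm (B N : nat) : nat := ex_minn (ordm_ex B N).

Lemma ordmP (B N : nat) : coprime B N ->
  [/\ 0 < ordm B N, B ^ ordm B N = 1 %[mod N] &
      forall e, 0 < e -> B ^ e = 1 %[mod N] -> ordm B N <= e].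
Proof.
move=> coBN; rewrite /ordm; case: ex_minnP => e.
rewrite coBN /= => /andP[e_gt0 /eqP Be] emin; split=> // f f_gt0 /eqP Bf.
by apply: emin; rewrite f_gt0.
Qed.

(* a_i = floor (B^i * x / N) mod B, the i-th digit after the radix point (i
   counted from 1) of the base-B expansion of x / N, for x < N; long division
   never produces a tail of digits all equal to B - 1. *)
Definition digit (B N x i : nat) : nat := ((B ^ i * x) %/ N) %% B.

Lemma digit_lt (B N x i : nat) : 0 < B -> digit B N x i < B.
Proof. exact: ltn_pmod. Qed.

Lemma digit_trunc (B N x n : nat) : 0 < B -> x < N ->
  (B ^ n * x) %/ N = \sum_(1 <= i < n.+1) digit B N x i * B ^ (n - i).
Proof.
move=> B_gt0 ltxN; have N_gt0 : 0 < N by apply: leq_ltn_trans ltxN.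
elim: n => [|n IHn]; first by rewrite mul1n divn_small // big_geq.
rewrite big_nat_recr //= subnn muln1 [LHS](divn_eq _ B) /digit.
congr (_ + _).
rewrite expnS -mulnA divnAC mulKn // IHn big_distrl /=.
rewrite [LHS]big_nat [RHS]big_nat; apply: eq_bigr => i /andP[_ lein].
by rewrite subSn // expnSr mulnA.
Qed.

Definition blen (d B N : nat) : nat := ordm B N %/ d.

Definition blocksum (d B N x : nat) : nat :=
  \sum_(1 <= j < d.+1) \sum_(1 <= i < (blen d B N).+1)
    digit B N x ((j - 1) * blen d B N + i) * B ^ (blen d B N - i).

Definition in_M (d B N : nat) : Prop :=
  d %| ordm B N /\
  forall x, 1 <= x < N -> coprime x N ->
    blocksum d B N x = 0 %[mod B ^ blen d B N - 1].

(* The division is exact when in_M d B N, 1 <= x < N and coprime x N. *)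
Definition mult (d B N x : nat) : nat :=
  blocksum d B N x %/ (B ^ blen d B N - 1).

(* Main.v *)
Require Import Defs.
From mathcomp Require Import all_boot.
From mathcomp Require Import zify.

(** Let [r_j] be the residue of [B ^ (j * k) * x] modulo [N]. The [j]-th block
    is [floor (B ^ k * r_j / N) = (B ^ k * r_j - r_(j+1)) / N], so summing over
    one period gives [N * S_d(x) = (B ^ k - 1) * (r_0 + ... + r_(d-1))], that
    is, [N * m_d(x) = r_0 + ... + r_(d-1)].
    For [d = 3] and [q = B ^ k], the case [x = 1] gives [N %| 1 + q + q ^ 2],
    and [x + r_1 + r_2 <= x + 2 * (N - 1)] leaves only the values [1] and [2]
    for [m_3(x)] when [x <= 3]. The value [2] is impossible for [x = 1]. For
    [x = 2] it forces [2 * q = 2 * q ^ 2 = -1] modulo [N], hence [N %| 3], while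
    no order modulo [3] is a multiple of [3]. For [x = 3] it forces [3 * q] and
    [3 * q ^ 2] to be [-1] and [-2] in some order, hence [N %| 7]. *)

(** Removing the multiples of [N] from [B ^ s * x] lowers the integer part by a multiple of [B ^ i],
    which vanishes modulo [B] because [0 < i]. *)
Lemma digit_shift (B N x s i : nat) : 0 < N -> 0 < i ->
  digit B N x (s + i) = digit B N ((B ^ s * x) %% N) i.
Proof.
move=> N_gt0 i_gt0; rewrite /digit expnD mulnAC mulnC.
rewrite [in LHS](divn_eq (B ^ s * x) N) mulnDr mulnA divnMDl //.
by case: i i_gt0 => // i _; rewrite expnS -!mulnA -modnDml modnMr.
Qed.

Lemma block_residue (B N x s k : nat) : 0 < B -> 0 < N ->
  (\sum_(1 <= i < k.+1) digit B N x (s + i) * B ^ (k - i)) * N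
    + (B ^ (s + k) * x) %% N = B ^ k * ((B ^ s * x) %% N).
Proof.
move=> B_gt0 N_gt0.
rewrite big_nat (eq_bigr (fun i =>
  digit B N ((B ^ s * x) %% N) i * B ^ (k - i))); last first.
  by move=> i /andP[i_gt0 _]; rewrite digit_shift.
rewrite -big_nat -digit_trunc ?ltn_mod //.
have -> : (B ^ (s + k) * x) %% N = (B ^ k * ((B ^ s * x) %% N)) %% N.
  by rewrite modnMmr mulnA -expnD addnC.
by rewrite -divn_eq.
Qed.

Lemma blocksum_residues (d B N x : nat) :
    0 < B -> 0 < N -> coprime B N -> d %| ordm B N ->
  blocksum d B N x * N =
    (B ^ blen d B N - 1) * \sum_(0 <= j < d) (B ^ (j * blen d B N) * x) %% N.
Proof.
move=> B_gt0 N_gt0 coBN dvd_d; have [_ Be _] := ordmP coBN.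
rewrite /blocksum; set k := blen d B N.
have dk : d * k = ordm B N by rewrite mulnC divnK.
pose r j := (B ^ (j * k) * x) %% N.
(* The residues have period [d], as [B ^ (d * k)] is 1 modulo [N]. *)
have r_cycle : \sum_(0 <= j < d) r j.+1 = \sum_(0 <= j < d) r j.
  have /eqP := big_nat_recr d 0 r (leq0n d) (op := addn) (idx := 0).
  rewrite big_nat_recl //=.
  have -> : r d = r 0 by rewrite /r dk -modnMml Be modnMml mul0n expn0.
  by rewrite addnC eqn_add2r => /eqP.
rewrite mulnBl mul1n -[X in _ = _ - X]r_cycle.
rewrite -[LHS](addnK (\sum_(0 <= j < d) r j.+1)).
congr (_ - _).
rewrite big_add1 /= big_distrl -big_split big_distrr /=.
apply: eq_bigr => j _.
by rewrite subn1 /= /r mulSn [k + _]addnC block_residue.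
Qed.

Lemma mult_residues (d B N x : nat) :
    1 < B -> 0 < N -> coprime B N -> 0 < blen d B N -> in_M d B N ->
    1 <= x < N -> coprime x N ->
  mult d B N x * N = \sum_(0 <= j < d) (B ^ (j * blen d B N) * x) %% N.
Proof.
move=> B_gt1 N_gt0 coBN k_gt0 [dvd_d M] x_bnd cox.
have /eqP := M x x_bnd cox; rewrite mod0n => dvd_S.
have Bk_gt0 : 0 < B ^ blen d B N - 1.
  by rewrite subn_gt0 -{1}(exp1n (blen d B N)) ltn_exp2r.
apply/eqP; rewrite -(eqn_pmul2l Bk_gt0) mulnA [_ * mult _ _ _ _]mulnC.
by rewrite /mult divnK // blocksum_residues // ltnW.
Qed.

Lemma double_residues_dvd3 (N p q : nat) :
    0 < N -> 1 + q + p = N -> N %| q * q + q + 1 ->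
  2 + (q * 2) %% N + (p * 2) %% N = 2 * N -> N %| 3.
Proof.
move=> N_gt0 pq /dvdnP[t qq].
have := ltn_pmod (q * 2) N_gt0; have := ltn_pmod (p * 2) N_gt0.
have := divn_eq (q * 2) N; have := divn_eq (p * 2) N.
move: (q * 2 %/ N) (p * 2 %/ N) (q * 2 %% N) (p * 2 %% N) => a b r1 r2.
move=> p2 q2 r2_lt r1_lt sumE.
(* Both residues must be [N - 1]; their sum is already [2 * q + 2 * p], so the quotients vanish. *)
have /eqP : (a + b) * N = 0 by lia.
rewrite muln_eq0 addn_eq0 (gtn_eqF N_gt0) orbF => /andP[/eqP a0 _].
have q2N : 2 * q + 1 = N by move: q2; rewrite a0; lia.
(* Completing the square: [4 * (q * q + q + 1) = (2 * q + 1) ^ 2 + 3]. *)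
have -> : 3 = 4 * (t * N) - N * N by rewrite -qq -q2N; lia.
by rewrite dvdn_sub ?dvdn_mull.
Qed.

Lemma triple_residues_dvd7 (N p q : nat) :
    0 < N -> N %| q * q + q + 1 ->
  3 + (q * 3) %% N + (p * 3) %% N = 2 * N -> N %| 7.
Proof.
move=> N_gt0 /dvdnP[t qq].
have := ltn_pmod (q * 3) N_gt0; have := ltn_pmod (p * 3) N_gt0.
have := divn_eq (q * 3) N.
move: (q * 3 %/ N) (q * 3 %% N) (p * 3 %% N) => a r1 r2.
move=> q3 r2_lt r1_lt sumE.
have [r1E|r1E] : r1 = N - 1 \/ r1 = N - 2 by lia.
  (* Both cases use [9 * (q * q + q + 1) = (3 * q + 1) * (3 * q + 2) + 7], with [N] dividing one of
     the two factors. *)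
  have q3E : 3 * q + 1 = a.+1 * N by lia.
  have -> : 7 = 9 * (t * N) - (3 * q + 2) * (a.+1 * N).
    by rewrite -qq -q3E; lia.
  by rewrite dvdn_sub ?dvdn_mull.
have q3E : 3 * q + 2 = a.+1 * N by lia.
have -> : 7 = 9 * (t * N) - (3 * q + 1) * (a.+1 * N).
  by rewrite -qq -q3E; lia.
by rewrite dvdn_sub ?dvdn_mull.
Qed.

Theorem theorem7 (B N k : nat) (hB : 1 < B) (hN : 1 < N) (hNB : coprime N B)
  (he : ordm B N = 3 * k) (hM : in_M 3 B N) :
  [/\ mult 3 B N 1 = 1,
      odd N -> mult 3 B N 2 = 1 &
      ~~ (3 %| N) -> N <> 7 -> mult 3 B N 3 = 1].
Proof.
have coBN : coprime B N by rewrite coprime_sym.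
have N_gt0 := ltnW hN.
have [e_gt0 _ emin] := ordmP coBN.
have k_gt0 : 0 < k by lia.
have blenE : blen 3 B N = k by rewrite /blen he mulKn.
pose q := B ^ k %% N; pose p := B ^ (2 * k) %% N.
have ltqN : q < N by rewrite ltn_mod.
have ltpN : p < N by rewrite ltn_mod.
have multE x : 1 <= x < N -> coprime x N ->
    mult 3 B N x * N = x + (q * x) %% N + (p * x) %% N.
  move=> x_bnd cox; rewrite mult_residues ?blenE //.
  rewrite !big_nat_recr //= big_geq //= mul0n expn0 mul1n add0n mul1n.
  by rewrite !modnMml [x %% N]modn_small //; case/andP: x_bnd.
have m1 : mult 3 B N 1 * N = 1 + q + p.
  by rewrite multE ?coprime1n ?hN // !muln1 !(modn_small, ltqN, ltpN).
(* As [q] and [p] are below [N], [1 + q + p] lies strictly between 0 and [2 * N]. *)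
have mult1 : mult 3 B N 1 = 1 by nia.
have pq : 1 + q + p = N by rewrite -m1 mult1 mul1n.
have pE : p = q * q %[mod N].
  by rewrite /p /q modn_mod modnMml modnMmr mul2n -addnn expnD.
have qq : N %| q * q + q + 1.
  rewrite /dvdn -addnA -modnDml -pE modnDml.
  by rewrite (_ : p + (q + 1) = N) ?modnn // -pq addnC [q + 1]addnC.
(* Unit squares are 1 modulo 3, so [B ^ (2 * k)] would be 1, against the minimality of [3 * k]. *)
have neqN3 : N <> 3.
  move=> N3; suff B2k : B ^ (2 * k) = 1 %[mod N].
    have := emin (2 * k); rewrite he leq_pmul2r // muln_gt0 k_gt0.
    by move=> /(_ isT B2k).
  rewrite expnM; move: coBN; rewrite N3 coprime_sym prime_coprime // => B3.
  have B1 : B ^ 2 = 1 %[mod 3].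
    rewrite -modnXm; move: B3; rewrite /dvdn.
    by have := ltn_pmod B (isT : 0 < 3); case: (B %% 3) => [|[|[|]]].
  by rewrite -modnXm B1 modnXm exp1n.
have sum_two m s : m * N = s -> 0 < s < 3 * N -> m != 1 -> s = 2 * N.
  by case: m => [|[|[|m]]] // <-; rewrite ltn_pmul2r // => /andP[].
have lt_res x := ltn_pmod x N_gt0.
clearbody p q; clear emin he hM.
split=> //.
- move=> oddN; have gt2 : 2 < N by lia.
  have := multE 2; rewrite gt2 coprime2n => /(_ isT oddN) mE.
  apply/eqP/idPn => /(sum_two _ _ mE) sumE.
  have : N %| 3.
    apply: (double_residues_dvd3 _ p q N_gt0 pq qq); apply: sumE.
    by have := lt_res (q * 2); have := lt_res (p * 2); lia.
  by rewrite dvdn_divisors // !inE => /orP[] /eqP; lia.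
- move=> N3 N7.
  have gt3 : 3 < N.
    (* [N = 2] is excluded because [q * q + q + 1] is odd. *)
    suff : N <> 2 by lia.
    by move=> N2; move: (q) qq ltqN; rewrite N2 => -[|[|]].
  have := multE 3; rewrite gt3 prime_coprime // => /(_ isT N3) mE.
  apply/eqP/idPn => /(sum_two _ _ mE) sumE.
  have : N %| 7.
    apply: (triple_residues_dvd7 _ p q N_gt0 qq); apply: sumE.
    by have := lt_res (q * 3); have := lt_res (p * 3); lia.
  by rewrite dvdn_divisors // !inE => /orP[] /eqP; lia.
Qed.
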